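(* For every integer $n\ge 1$, $E_{1,n}=-(n-1)B_n$.
   Context: $B_n$ denote the Bernoulli numbers, $\frac{t}{e^t-1}=\sum_{n\ge0}B_n\frac{t^n}{n!}$. The hypergeometric Euler numbers $E_{1,n}$ are defined by $\dfrac{1}{\sum_{m\ge 0}\frac{2!}{(2+2m)!}t^{2m}}=\sum_{n=0}^\infty E_{1,n}\frac{t^n}{n!}$, i.e. $\sum_n E_{1,n}t^n/n!=\dfrac{t^2/2}{\cosh t-1}$ (this is the case $N=1$ of $1/{}_1F_2(1;N+1,\tfrac{2N+1}{2};\tfrac{t^2}{4})=\sum_n E_{N,n}t^n/n!$). *)

(* Defs.v *)
From mathcomp Require Import all_boot all_order all_algebra.

Set Implicit Arguments.
Unset Strict Implicit.
Unset Printing Implicit Defensive.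

Import Order.TTheory GRing.Theory Num.Theory.
Local Open Scope ring_scope.

(* A formal power series over [R] is represented by its coefficient sequence
   [nat -> R]; equality of series is pointwise equality [=1]. *)
Section FormalPowerSeries.
Variable R : fieldType.
Implicit Types f g a : nat -> R.

(* The monomial t^k. *)
Definition fpsXn (k : nat) : nat -> R := fun n => (n == k)%:R.

Definition fps_sub f g : nat -> R := fun n => f n - g n.

Definition fps_mul f g : nat -> R :=
  fun n => \sum_(i < n.+1) f (n - i)%N * g i.

(* The series f / t, for f without constant term. *)
Definition fps_divX f : nat -> R := fun n => f n.+1.

(* [fps_inv_seq f n] lists the coefficients 0, ..., n of 1 / f; they are
   obtained by solving f * (1 / f) = 1 coefficient by coefficient, which
   requires f 0 != 0 (see [fps_mulV]). *)
Fixpoint fps_inv_seq f (n : nat) : seq R :=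
  if n is m.+1 then
    let s := fps_inv_seq f m in
    rcons s (- (f 0%N)^-1 * \sum_(i < m.+1) f (m.+1 - i)%N * s`_i)
  else [:: (f 0%N)^-1].

Definition fps_inv f : nat -> R := fun n => (fps_inv_seq f n)`_n.

Definition fps_exp : nat -> R := fun n => (n`!%:R)^-1.

(* The exponential generating series \sum_n a_n t^n / n!. *)
Definition fps_egf a : nat -> R := fun n => a n / n`!%:R.

Lemma size_fps_inv_seq f n : size (fps_inv_seq f n) = n.+1.
Proof. by elim: n => //= n IHn; rewrite size_rcons IHn. Qed.

Lemma nth_fps_inv_seq f n i :
  (i <= n)%N -> (fps_inv_seq f n)`_i = fps_inv f i.
Proof.
elim: n => [|n IHn]; first by rewrite leqn0 => /eqP->.
rewrite leq_eqVlt => /predU1P[-> //|lt_in].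
by rewrite /= nth_rcons size_fps_inv_seq lt_in IHn.
Qed.

Lemma fps_mulV f : f 0%N != 0 -> fps_mul f (fps_inv f) =1 fpsXn 0.
Proof.
move=> f0 [|n]; rewrite /fps_mul /fpsXn.
  by rewrite big_ord_recr big_ord0 /= add0r /fps_inv /= divff.
rewrite big_ord_recr /= subnn {2}/fps_inv /= nth_rcons size_fps_inv_seq.
rewrite ltnn eqxx mulrA mulrN divff // mulN1r.
rewrite [X in _ - X](eq_bigr (fun i : 'I_n.+1 =>
  f (n.+1 - i)%N * fps_inv f i)) ?subrr // => i _.
by rewrite nth_fps_inv_seq // -ltnS.
Qed.

End FormalPowerSeries.

Arguments fpsXn {R} k n.
Arguments fps_exp {R} n.

(* (e^t - 1) / t; [bernoulli_gf] checks that the numbers below are those of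
   the expansion of t / (e^t - 1). *)
Definition bernoulli_den : nat -> rat := fps_divX (fps_sub fps_exp (fpsXn 0)).

Definition bernoulli (n : nat) : rat := n`!%:R * fps_inv bernoulli_den n.

(* \sum_(m >= 0) 2! / (2 + 2m)! t^(2m). *)
Definition hyp_euler1_den : nat -> rat :=
  fun k => if odd k then 0 else (2`!)%:R / ((2 + k)`!)%:R.

(* The hypergeometric Euler numbers E_{1,n}. *)
Definition hyp_euler1 (n : nat) : rat := n`!%:R * fps_inv hyp_euler1_den n.

Lemma fps_egfK (a : nat -> rat) : fps_egf (fun n => n`!%:R * a n) =1 a.
Proof.
move=> n; rewrite /fps_egf mulrAC divff ?mul1r //.
by rewrite pnatr_eq0 -lt0n fact_gt0.
Qed.

Lemma bernoulli_gf :
  fps_mul (fps_sub fps_exp (fpsXn 0)) (fps_egf bernoulli) =1 fpsXn 1.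
Proof.
have exp0 : fps_sub fps_exp (fpsXn 0) 0%N = 0 :> rat by [].
move=> [|n]; rewrite /fps_mul big_ord_recr /= subnn exp0 mul0r addr0.
  by rewrite big_ord0.
rewrite -[RHS]/(fpsXn 0 n) -(@fps_mulV _ bernoulli_den) //.
apply: eq_bigr => i _; rewrite fps_egfK subSn //.
by rewrite -ltnS.
Qed.

Lemma hyp_euler1_gf :
  fps_mul hyp_euler1_den (fps_egf hyp_euler1) =1 fpsXn 0.
Proof.
move=> n; rewrite -(@fps_mulV _ hyp_euler1_den) //.
by apply: eq_bigr => i _; rewrite fps_egfK.
Qed.

(* Main.v *)
Require Import Defs.
From mathcomp Require Import all_boot all_order all_algebra.
From mathcomp Require Import ring.

Import Order.TTheory GRing.Theory Num.Theory.
Local Open Scope ring_scope.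

(** Put P = (e^t - 1) / t and b = 1 / P, the generating series of the B_n / n!.
    The generating series of the (1 - n) B_n / n! is G = b - t b'. Applying
    t d/dt to P b = 1 gives P G = b (P + t P') = b e^t. On the other hand
    2 (cosh t - 1) / t^2 = P(t) P(-t) and e^t P(-t) = P(t), so that
    P(t) P(-t) G = P(-t) e^t b = P b = 1. *)

Section FormalPowerSeriesTheory.
Local Set Implicit Arguments.
Local Unset Strict Implicit.
Variable R : fieldType.
Implicit Types f g h : nat -> R.

Lemma eq_fps_mul f f' g g' :
  f =1 f' -> g =1 g' -> fps_mul f g =1 fps_mul f' g'.
Proof. by move=> ff' gg' n; apply: eq_bigr => i _; rewrite ff' gg'. Qed.

(** A coefficient of index at most [n] only sees the truncations at degree [n], so commutativity and
    associativity can be borrowed from [{poly R}]. *)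
Lemma fps_mul_poly n f g i : (i <= n)%N ->
  fps_mul f g i = ((\poly_(j < n.+1) f j) * (\poly_(j < n.+1) g j))`_i.
Proof.
move=> le_in; rewrite coefMr; apply: eq_bigr => j _.
have le_jn : (j <= n)%N by apply: leq_trans le_in; rewrite -ltnS.
by rewrite !coef_poly !ltnS le_jn (leq_trans (leq_subr _ _) le_in).
Qed.

Lemma fps_mulC f g : fps_mul f g =1 fps_mul g f.
Proof. by move=> n; rewrite !(@fps_mul_poly n) // mulrC. Qed.

Lemma fps_mulA f g h :
  fps_mul f (fps_mul g h) =1 fps_mul (fps_mul f g) h.
Proof.
move=> n; pose T k := \poly_(j < n.+1) k j : {poly R}.
transitivity ((T f * (T g * T h))`_n).
  rewrite coefMr; apply: eq_bigr => j _.
  by rewrite coef_poly ltnS leq_subr (@fps_mul_poly n) // -ltnS.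
rewrite mulrA coefMr; apply: eq_bigr => j _.
by rewrite [X in _ * X = _]coef_poly ltn_ord (@fps_mul_poly n) // leq_subr.
Qed.

Lemma fps_mul1 f : fps_mul f (fpsXn 0) =1 f.
Proof.
move=> n; rewrite /fps_mul big_ord_recl /= subn0 mulr1 big1 ?addr0 // => i _.
by rewrite mulr0.
Qed.

Lemma fps_inv_unique f g : f 0%N != 0 ->
  fps_mul f g =1 fpsXn 0 -> fps_inv f =1 g.
Proof.
move=> f0 fg n; rewrite -(fps_mul1 (fps_inv f)).
rewrite -(eq_fps_mul (frefl _) fg) fps_mulA.
rewrite (eq_fps_mul (fps_mulC _ _) (frefl g)).
by rewrite (eq_fps_mul (fps_mulV f0) (frefl g)) fps_mulC fps_mul1.
Qed.

(** Leibniz rule for the derivation t d/dt, which scales coefficient [n] by [n]; termwise it is n =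
    (n - i) + i. *)
Lemma fps_mul_euler f g n :
  n%:R * fps_mul f g n =
  fps_mul (fun i => i%:R * f i) g n + fps_mul f (fun i => i%:R * g i) n.
Proof.
rewrite /fps_mul mulr_sumr -big_split; apply: eq_bigr => i _ /=.
by rewrite natrB -1?ltnS //; ring.
Qed.

End FormalPowerSeriesTheory.

Lemma natr_fact_neq0 (n : nat) : n`!%:R != 0 :> rat.
Proof. by rewrite pnatr_eq0 -lt0n fact_gt0. Qed.

(** Coefficient of t^m in e^(-t) e^t = 1; multiplied by [m!] it is the binomial expansion of (1 -
    1)^m. *)
Lemma sum_sign_fact (m : nat) : (0 < m)%N ->
  \sum_(j < m.+1) (-1) ^+ j / (j`!%:R * (m - j)`!%:R) = 0 :> rat.
Proof.
move=> m_gt0; apply: (mulfI (natr_fact_neq0 m)); rewrite mulr0 mulr_sumr.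
transitivity ((1 - 1) ^+ m : rat); last by rewrite subrr expr0n gtn_eqF.
rewrite exprBn; apply: eq_bigr => j _.
have le_jm : (j <= m)%N by rewrite -ltnS.
rewrite !expr1n !mulr1 -(bin_fact le_jm) !natrM -[RHS]mulr_natr.
by field; rewrite !natr_fact_neq0.
Qed.

Lemma bernoulli_denE (n : nat) : bernoulli_den n = n.+1`!%:R^-1.
Proof. by rewrite /bernoulli_den /fps_divX /fps_sub /fpsXn subr0. Qed.

(* [P(-t) = (1 - e^(-t)) / t] *)
Definition bernoulli_denN (n : nat) : rat := (-1) ^+ n * bernoulli_den n.

Lemma fps_exp_mul_bernoulli_denN :
  fps_mul fps_exp bernoulli_denN =1 bernoulli_den.
Proof.
(* With m = n + 1, the term j = 0 is the coefficient of P(t); the terms j = i + 1 are, up to sign,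
   those of the convolution. *)
move=> n; have := sum_sign_fact _ (ltn0Sn n); rewrite big_ord_recl.
move/(canRL (addrK _)); rewrite sub0r subn0 fact0 !mul1r => eq_sum.
rewrite bernoulli_denE eq_sum -sumrN; apply: eq_bigr => i _.
rewrite /bernoulli_denN bernoulli_denE /fps_exp /= subSS exprS invfM; ring.
Qed.

Lemma hyp_euler1_den_factor :
  fps_mul bernoulli_den bernoulli_denN =1 hyp_euler1_den.
Proof.
(* This is (e^t - 1)(1 - e^(-t)) = e^t + e^(-t) - 2, divided by t^2. With m = n + 2, the two extreme
   terms of the sum give the right-hand side and the inner ones, negated, the product. *)
move=> n; have := sum_sign_fact _ (ltn0Sn n.+1).
rewrite big_ord_recl big_ord_recr /= subn0 subnn fact0 !mul1r mulr1.
rewrite !exprS !mulN1r opprK => eq_sum.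
have -> : hyp_euler1_den n = (n.+2)`!%:R^-1 + (-1) ^+ n / (n.+2)`!%:R.
  rewrite /hyp_euler1_den -signr_odd; case: (odd n) => /=.
    by rewrite expr1 mulN1r subrr.
  by rewrite expr0 mul1r add2n -[2`!%:R]/(1 + 1 : rat) mulrDl mul1r.
move: eq_sum; rewrite addrCA addrC => /(canRL (addrK _)).
rewrite sub0r [_ + _ / _]addrC.
move=> ->; rewrite -sumrN; apply: eq_bigr => i _.
rewrite /bernoulli_denN !bernoulli_denE /bump /= add1n subSS subSn -1?ltnS //.
by rewrite exprS invfM; ring.
Qed.

Lemma bernoulli_den_mul_euler :
  fps_mul bernoulli_den (fun n => (1 - n%:R) * fps_inv bernoulli_den n)
  =1 fps_mul fps_exp (fps_inv bernoulli_den).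
Proof.
move=> n; set P := bernoulli_den; set b := fps_inv P.
have Pb : fps_mul P b =1 fpsXn 0 by apply: fps_mulV.
(* e^t = P + t P', the derivative of t P = e^t - 1. *)
have exp_P i : fps_exp i = P i + i%:R * P i.
  rewrite /P bernoulli_denE /fps_exp factS natrM invfM -[i.+1]add1n natrD.
  by field; rewrite natr_fact_neq0 ?nat1r ?pnatr_eq0.
have := fps_mul_euler P b n; rewrite {1}Pb /fpsXn.
(* t d/dt kills the constant series P b = 1, whence P (t b') = - (t P') b. *)
have -> : n%:R * (n == 0%N)%:R = 0 :> rat.
  by case: n => [|n]; rewrite ?mul0r ?mulr0.
move/esym/(canRL (addrK _)); rewrite sub0r => dPb.
transitivity (fps_mul P b n - fps_mul P (fun i => i%:R * b i) n).
  by rewrite /fps_mul -sumrB; apply: eq_bigr => i _; ring.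
transitivity (fps_mul P b n + fps_mul (fun i => i%:R * P i) b n).
  by rewrite dPb.
by rewrite /fps_mul -big_split; apply: eq_bigr => i _; rewrite exp_P /=; ring.
Qed.

Theorem theorem2 (n : nat) (hn : (1 <= n)%N) :
  hyp_euler1 n = - (n%:R - 1) * bernoulli n.
Proof.
rewrite /hyp_euler1 /bernoulli opprB mulrCA; congr (_ * _).
set b := fps_inv bernoulli_den.
(* With [n!] cancelled, it remains to see that G inverts P(t) P(-t). *)
apply: (@fps_inv_unique _ _ (fun n => (1 - n%:R) * b n)) => // {hn}n.
rewrite -(eq_fps_mul hyp_euler1_den_factor (frefl _)).
rewrite (eq_fps_mul (fps_mulC _ _) (frefl _)) -fps_mulA.
rewrite (eq_fps_mul (frefl _) bernoulli_den_mul_euler) fps_mulA.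
rewrite (eq_fps_mul (fps_mulC _ _) (frefl _)).
rewrite (eq_fps_mul fps_exp_mul_bernoulli_denN (frefl _)).
exact: fps_mulV.
Qed.
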